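(* For all $z\in\mathcal{D}$ and $n\in\mathbb{N}$, we have $$\bigl|d_{\mathfrak p}\bigl(0,U_n(z)\bigr)-|\omega_n|\bigr|\leq d_{\mathfrak p}(0,z).$$
   Context: $\mathcal{D}$ is the open unit disk in $\mathbb{C}$ centered at $0$, $\overline{\mathcal{D}}$ its closure, $\partial\mathcal{D}$ the unit circle. Fix $\alpha\in\partial\mathcal{D}$. For $x\in(-1,1)$ let $q_{x,\alpha}(z)=\frac{z+x\alpha}{1+x\bar\alpha z}$ for $z\in\overline{\mathcal{D}}$. For $\gamma\in\mathbb{R}$ let $g_\gamma:=q_{x,\alpha}$ where $x\in(-1,1)$ is determined by $\gamma=\log\frac{1+x}{1-x}$. Let $(x_n)_{n\in\mathbb{N}}$ be a stationary and ergodic sequence of random variables with values in $(-1,1)$; put $\gamma_n=\log\frac{1+x_n}{1-x_n}$, $\omega_0=0$, $\omega_n=\sum_{i=1}^n\gamma_i$, and $U_n:=g_{\omega_n}$ for $n\in\mathbb{Z}_+=\mathbb{N}\cup\{0\}$. The claim holds for every realization of the sequence. The Poincar\'e distance on $\mathcal{D}$ is $d_{\mathfrak p}(z,w)=\log\Bigl(\frac{1+\rho_{z,w}}{1-\rho_{z,w}}\Bigr)$ with $\rho_{z,w}=\Bigl|\frac{z-w}{1-\bar z w}\Bigr|$. *)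

(* Defs.v *)
From HB Require Import structures.
From mathcomp Require Import all_boot all_order all_algebra.
From mathcomp Require Import all_classical all_reals all_analysis.
From mathcomp Require Import complex.
From mathcomp Require Import ring lra.

Set Implicit Arguments.
Unset Strict Implicit.
Unset Printing Implicit Defensive.

Import Order.TTheory GRing.Theory Num.Theory.
Import numFieldNormedType.Exports.

Local Open Scope classical_set_scope.
Local Open Scope ring_scope.
Local Open Scope complex_scope.

(* [Normc.normc z : R] is the modulus as a real number; the generic [`|z|]
   on R[i] lives in R[i]. *)

Definition unit_disk (R : realType) : set R[i] :=
  [set z | Normc.normc z < 1].

Definition unit_circle (R : realType) : set R[i] :=
  [set z | Normc.normc z = 1].

Definition mobius (R : realType) (x : R) (alpha z : R[i]) : R[i] :=
  (z + x%:C * alpha) / (1 + x%:C * alpha^* * z).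

Definition log_ratio (R : realType) (x : R) : R := ln ((1 + x) / (1 - x)).

Lemma log_ratio_bij (R : realType) (gamma : R) :
  exists! x : R, -1 < x < 1 /\ gamma = log_ratio x.
Proof.
have e0 := expR_gt0 gamma.
have e1 : expR gamma + 1 != 0 by rewrite gt_eqF // addr_gt0.
exists ((expR gamma - 1) / (expR gamma + 1)); split.
  split.
    by rewrite ltr_pdivlMr ?ltr_pdivrMr; lra.
  rewrite /log_ratio -[LHS]expRK; congr ln; field.
  by rewrite e1 /= (_ : _ - _ = 2) ?pnatr_eq0 //; ring.
move=> x [/andP[x1 x2] ->].
have p0 : 0 < 1 - x by rewrite subr_gt0.
have p1 : 0 < (1 + x) / (1 - x) by rewrite divr_gt0 //; lra.
rewrite lnK ?posrE //; field.
rewrite gt_eqF //= (_ : _ + _ = 2) ?pnatr_eq0 //; ring.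
Qed.

(* The x in (-1, 1) with gamma = log_ratio x; the default value 0 of [xget] is
   irrelevant by [log_ratio_bij]. *)
Definition log_ratio_inv (R : realType) (gamma : R) : R :=
  xget 0 [set x : R | -1 < x < 1 /\ gamma = log_ratio x].

Definition gflow (R : realType) (alpha : R[i]) (gamma : R) : R[i] -> R[i] :=
  mobius (log_ratio_inv gamma) alpha.

(* Sequences indexed by {1, 2, ...} are encoded as functions on nat with
   [x k] standing for x_(k+1), hence omega_n = \sum_(k < n) log_ratio (x k). *)
Definition omega (R : realType) (x : nat -> R) (n : nat) : R :=
  \sum_(k < n) log_ratio (x k).

Definition Uwalk (R : realType) (alpha : R[i]) (x : nat -> R) (n : nat) :
    R[i] -> R[i] :=
  gflow alpha (omega x n).

Definition poincare_rho (R : realType) (z w : R[i]) : R :=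
  Normc.normc ((z - w) / (1 - z^* * w)).

Definition poincare_dist (R : realType) (z w : R[i]) : R :=
  ln ((1 + poincare_rho z w) / (1 - poincare_rho z w)).

(* Product sigma-algebra on the sequence space R^nat. *)
Definition seq_measurable (R : realType) : set (set (nat -> R)) :=
  <<s [set A | exists k (B : set R),
         measurable B /\ A = [set u | B (u k)]] >>.

Definition shift (R : Type) (u : nat -> R) : nat -> R := fun k => u k.+1.

Definition stationary (R : realType) (d : measure_display)
    (T : measurableType d) (P : probability T R) (X : nat -> {RV P >-> R}) :=
  forall A : set (nat -> R), seq_measurable A ->
    P [set t | A (shift (fun k => X k t))] = P [set t | A (fun k => X k t)].

(* Triviality of the shift-invariant sigma-algebra under the law of X. *)
Definition ergodic (R : realType) (d : measure_display)
    (T : measurableType d) (P : probability T R) (X : nat -> {RV P >-> R}) :=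
  forall A : set (nat -> R), seq_measurable A ->
    @shift R @^-1` A = A ->
    P [set t | A (fun k => X k t)] = 0%E \/
    P [set t | A (fun k => X k t)] = 1%E.

(* Main.v *)
(* Since [d(0, w) = log_ratio |w|] and [|log_ratio x| = log_ratio |x|], the claim
   is a pair of triangle inequalities between [log_ratio] of [|z|], [|b|] and
   [|(z + b) / (1 + b^* z)|], where [b = x alpha].  As
   [log_ratio u + log_ratio v = log_ratio ((u + v) / (1 + u v))], these read
   [m (1 + |z||b|) <= |z| + |b|] and [|b| (1 + m |z|) <= m + |z|], with [m] the
   modulus of the quotient.  Both follow from
   [m^2 = (|z|^2 + |b|^2 + t) / (1 + |z|^2 |b|^2 + t)], [t = 2 Re (b^* z)]. *)
Require Import Defs.
From HB Require Import structures.
From mathcomp Require Import all_boot all_order all_algebra.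
From mathcomp Require Import all_classical all_reals all_analysis.
From mathcomp Require Import complex.
From mathcomp Require Import ring lra.

Import Order.TTheory GRing.Theory Num.Theory.
Import numFieldNormedType.Exports.

Local Open Scope classical_set_scope.
Local Open Scope ring_scope.
Local Open Scope complex_scope.

Lemma log_ratio_arg_gt0 (R : realType) (x : R) :
  -1 < x < 1 -> 0 < (1 + x) / (1 - x).
Proof. by move=> /andP[x1 x2]; rewrite divr_gt0 //; lra. Qed.

Lemma log_ratioN (R : realType) (x : R) :
  -1 < x < 1 -> log_ratio (- x) = - log_ratio x.
Proof.
move=> hx; rewrite /log_ratio opprK -lnV ?posrE ?log_ratio_arg_gt0 //.
by rewrite invf_div.
Qed.

Lemma log_ratio_ge0 (R : realType) (x : R) : 0 <= x < 1 -> 0 <= log_ratio x.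
Proof.
by move=> /andP[x0 x1]; apply: ln_ge0; rewrite ler_pdivlMr; lra.
Qed.

Lemma norm_log_ratio (R : realType) (x : R) :
  -1 < x < 1 -> `|log_ratio x| = log_ratio `|x|.
Proof.
move=> hx; have [x0|x0] := leP 0 x.
  rewrite (ger0_norm x0) ger0_norm // log_ratio_ge0 // x0.
  by case/andP: hx.
rewrite (ltr0_norm x0) -normrN -log_ratioN // ger0_norm // log_ratio_ge0 //.
by case/andP: hx => ? _; lra.
Qed.

(** Exponentiating turns the sum into a product of quotients; after cross-multiplication the two
    sides differ by exactly [2 * (x + y - z * (1 + x * y))]. *)
Lemma log_ratio_leD (R : realType) (x y z : R) :
  -1 < x < 1 -> -1 < y < 1 -> -1 < z < 1 ->
  z * (1 + x * y) <= x + y -> log_ratio z <= log_ratio x + log_ratio y.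
Proof.
move=> hx hy hz h.
rewrite /log_ratio -lnM ?posrE ?log_ratio_arg_gt0 //.
rewrite ler_ln ?posrE ?log_ratio_arg_gt0 //; last first.
  by apply: mulr_gt0; exact: log_ratio_arg_gt0.
case/andP: hx => hx1 hx2; case/andP: hy => hy1 hy2; case/andP: hz => hz1 hz2.
rewrite mulf_div ler_pdivrMr; last lra.
rewrite mulrAC ler_pdivlMr; last by rewrite mulr_gt0 //; lra.
by lra.
Qed.

Lemma normc_ge0 (R : realType) (z : R[i]) : 0 <= Normc.normc z.
Proof. by case: z => a b; rewrite sqrtr_ge0. Qed.

Lemma sqr_normcE (R : realType) (a b : R) :
  Normc.normc (a +i* b) ^+ 2 = a ^+ 2 + b ^+ 2.
Proof. by rewrite sqr_sqrtr // addr_ge0 ?sqr_ge0. Qed.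

Lemma normc_blaschke (R : realType) (b z : R[i])
    (m := Normc.normc ((z + b) / (1 + b^* * z))) :
  Normc.normc b < 1 -> Normc.normc z < 1 ->
  [/\ m < 1,
      m * (1 + Normc.normc b * Normc.normc z) <= Normc.normc b + Normc.normc z &
      Normc.normc b * (1 + m * Normc.normc z) <= m + Normc.normc z].
Proof.
rewrite {}/m Normc.normcM Normc.normcV.
set a := Normc.normc b; set r := Normc.normc z.
set n := Normc.normc (z + b); set d := Normc.normc (1 + _) => a1 r1.
have a0 : 0 <= a by exact: normc_ge0.
have r0 : 0 <= r by exact: normc_ge0.
have n0 : 0 <= n by exact: normc_ge0.
have d0 : 0 <= d by exact: normc_ge0.
(* Both squared moduli carry the same cross term, twice the real part of [b^* * z]; its bound is
   Cauchy-Schwarz. *)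
have [t [nE dE tle]] : exists t, [/\ n ^+ 2 = a ^+ 2 + r ^+ 2 + t,
    d ^+ 2 = 1 + (a * r) ^+ 2 + t & `|t| <= 2 * (a * r)].
  rewrite /n /d /a /r; clear; case: b => p q; case: z => u v.
  exists (2 * (p * u + q * v)); split.
  - by rewrite !sqr_normcE; ring.
  - have -> : 1 + (p +i* q)^* * (u +i* v) =
              (1 + (p * u + q * v)) +i* (p * v - q * u).
      by simpc; congr (_ +i* _); ring.
    by rewrite exprMn !sqr_normcE; ring.
  - rewrite -ler_sqr ?nnegrE ?mulr_ge0 ?normc_ge0 //.
    rewrite real_normK ?num_real // !exprMn !sqr_normcE.
    (* Lagrange's identity: the gap in the squared bound is [4 * (p * v - q * u) ^+ 2]. *)
    have := sqr_ge0 (p * v - q * u); lra.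
have /andP[tl tu] : - (2 * (a * r)) <= t <= 2 * (a * r) by rewrite -ler_norml.
have ar1 : a * r < 1 by nra.
(* The lower bound on [t] gives [d ^+ 2 >= (1 - a * r) ^+ 2], which is positive. *)
have dp : 0 < d.
  by rewrite lt0r d0 andbT -sqrf_eq0 dE gt_eqF //; nra.
(* This product equals [d ^+ 2 - n ^+ 2]. Once denominators are cleared and sides squared, the gaps
   in the three claims are this product times [1], [2 * (a * r) - t] and [t + 2 * (a * r)]. *)
have ab_ge0 : 0 <= (1 - a ^+ 2) * (1 - r ^+ 2) by rewrite mulr_ge0 //; nra.
split.
- rewrite ltr_pdivrMr // mul1r -ltr_sqr ?nnegrE // nE dE.
  have : 0 < (1 - a ^+ 2) * (1 - r ^+ 2) by rewrite mulr_gt0 //; nra.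
  by lra.
- rewrite mulrAC ler_pdivrMr //.
  rewrite -ler_sqr ?nnegrE ?mulr_ge0 ?addr_ge0 ?mulr_ge0 // !exprMn nE dE.
  have : 0 <= (2 * (a * r) - t) * ((1 - a ^+ 2) * (1 - r ^+ 2)).
    by rewrite mulr_ge0 // subr_ge0.
  by lra.
- suff : (a - r) * d <= n * (1 - a * r).
    rewrite -(ler_pM2r dp (a * _)) => h.
    have -> : a * (1 + n / d * r) * d = a * d + a * n * r.
      by field; rewrite gt_eqF.
    have -> : (n / d + r) * d = n + r * d by field; rewrite gt_eqF.
    by lra.
  (* Squaring is legitimate only when [a - r] is nonnegative; otherwise the left side is at most 0
     and the right side at least 0. *)
  have [ar|ra] := leP a r.
    by apply: (@le_trans _ _ 0); [nra|rewrite mulr_ge0 //; lra].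
  rewrite -ler_sqr ?nnegrE ?mulr_ge0 ?subr_ge0 //; try exact: ltW.
  rewrite !exprMn nE dE.
  have : 0 <= (t + 2 * (a * r)) * ((1 - a ^+ 2) * (1 - r ^+ 2)).
    by rewrite mulr_ge0 // -lerBlDr sub0r.
  by lra.
Qed.

Lemma poincare_dist0 (R : realType) (z : R[i]) :
  poincare_dist 0 z = log_ratio (Normc.normc z).
Proof.
rewrite /poincare_dist /poincare_rho /log_ratio.
by rewrite sub0r rmorph0 mul0r subr0 divr1 normcN.
Qed.

Lemma log_ratio_invP (R : realType) (gamma : R) :
  -1 < log_ratio_inv gamma < 1 /\ gamma = log_ratio (log_ratio_inv gamma).
Proof.
have [x [hx _]] := log_ratio_bij gamma.
exact: (@xgetI _ 0 [set x : R | -1 < x < 1 /\ gamma = log_ratio x] x).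
Qed.

(** The walk at step [n] is the flow map at the single time [omega x n], so a bound uniform in
    [gamma] settles every realization. *)
Lemma poincare_dist0_gflow (R : realType) (alpha z : R[i]) (gamma : R) :
  unit_circle alpha -> unit_disk z ->
  `|poincare_dist 0 (gflow alpha gamma z) - `|gamma| | <= poincare_dist 0 z.
Proof.
rewrite /unit_circle /unit_disk /= => ha hz.
have [hx {2}->] := log_ratio_invP _ gamma.
rewrite /gflow /mobius; set x := log_ratio_inv gamma in hx *.
have xa : Normc.normc (x%:C * alpha) = `|x|.
  by rewrite Normc.normcM ha mulr1 /= expr0n addr0 sqrtr_sqr.
have x1 : `|x| < 1 by rewrite ltr_norml.
have -> : x%:C * alpha^* = (x%:C * alpha)^*.
  by rewrite rmorphM /= oppr0.
rewrite norm_log_ratio // !poincare_dist0.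
have [] := @normc_blaschke R (x%:C * alpha) z; rewrite ?xa //.
set m := Normc.normc (_ / _) => m1 h1 h2.
have itv (u : R) : 0 <= u -> u < 1 -> -1 < u < 1.
  by move=> u0 ->; rewrite andbT; lra.
have hr := itv _ (normc_ge0 _ _) hz; have hm := itv _ (normc_ge0 _ _) m1.
have hn := itv _ (normr_ge0 _) x1.
(* [h1] bounds the distance of the image point by [gamma] in absolute value plus that of [z]; [h2]
   gives the reverse triangle inequality. *)
have := log_ratio_leD _ _ _ _ hn hr hm h1.
have := log_ratio_leD _ _ _ _ hm hr hn h2.
by rewrite ler_norml => ? ?; lra.
Qed.

Theorem lemma10 (R : realType) (d : measure_display) (T : measurableType d)
    (P : probability T R) (alpha : R[i]) (X : nat -> {RV P >-> R})
    (halpha : unit_circle alpha)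
    (hX : forall (k : nat) (t : T), -1 < X k t < 1)
    (hstat : stationary X) (herg : ergodic X) :
  forall (t : T) (z : R[i]) (n : nat), unit_disk z -> (0 < n)%N ->
    `| poincare_dist 0 (Uwalk alpha (fun k => X k t) n z)
       - `| omega (fun k => X k t) n | | <= poincare_dist 0 z.
Proof. by move=> t z n hz _; exact: poincare_dist0_gflow. Qed.
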